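(* Let $X\dashrightarrow X^+$ be an elementary toric flop between smooth projective toric varieties, and let $R$ be the extremal ray on $X$ defining the flopping contraction. Identify $\mathrm{Pic}(X)$ and $\mathrm{Pic}(X^+)$ by strict transform. If $0\ne D\in\mathrm{Nef}(X)\cap\mathrm{Pic}(X)$ and $D\cdot R=0$, then its strict transform $D^+$ is nef and $$\tau_X(D;\mathbb K)=\tau_{X^+}(D^+;\mathbb K)\qquad(\mathbb K\in\{\mathbb Z,\mathbb Q\}).$$ In particular, if $X$ and $X^+$ are weak Fano, then $$\tau_X(\mathbb K)=\tau_{X^+}(\mathbb K)\quad(\mathbb K\in\{\mathbb Z,\mathbb Q\}),\qquad \delta(X)=\delta(X^+).$$
   Context: All toric varieties are over an algebraically closed field. Gongyo indices. For a smooth projective toric variety $X$, a nonzero class $D\in\mathrm{Nef}(X)\cap\mathrm{Pic}(X)$ and $\mathbb K\in\{\mathbb Z,\mathbb Q\}$, put $$\tau_X(D;\mathbb K)=\sup\Big\{\sum_{i=1}^r a_i\ \Big|\ D=\sum_{i=1}^r a_iD_i,\ 0\ne D_i\in\mathrm{Nef}(X)\cap\mathrm{Pic}(X),\ a_i\in\mathbb K_{>0}\Big\}$$ (for $\mathbb K=\mathbb Q$ the equality is in $\mathrm{Pic}(X)\otimes\mathbb Q$), and $\delta_X(D)=\tau_X(D;\mathbb Q)-\tau_X(D;\mathbb Z)$. If $-K_X$ is nef and nonzero, $\tau_X(\mathbb K):=\tau_X(-K_X;\mathbb K)$ and $\delta(X):=\delta_X(-K_X)$. Elementary toric flop: the birational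 toric map $X\dashrightarrow X^+$, an isomorphism in codimension one, associated with an extremal ray $R$ of the Mori cone of $X$ such that $K_X\cdot R=0$ and the contraction of $R$ is small, $X^+$ being the other small modification over the target of the contraction (with extremal ray $-R$ under the identification of numerical classes). In terms of fans, $R$ is spanned by the class of a primitive relation $x_1+\cdots+x_s=y_1+\cdots+y_s$ with $s\ge2$ and pairwise distinct ray generators; $X$ and $X^+$ have the same rays, and blowing up $X$ along the orbit closure of the cone $\langle y_1,\dots,y_s\rangle$ and $X^+$ along that of $\langle x_1,\dots,x_s\rangle$ yields the same toric variety. *)

(* Defs.v *)
From HB Require Import structures.
From mathcomp Require Import all_boot all_order all_algebra.
From mathcomp Require Import all_classical all_reals ereal.

Set Implicit Arguments.
Unset Strict Implicit.
Unset Printing Implicit Defensive.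
Import Order.TTheory GRing.Theory Num.Theory.
Local Open Scope ring_scope.

(* Toric varieties with torus of dimension n are given by fans in the lattice
   N = Z^n of row vectors; characters are column vectors u in M = Z^n, with
   <u, x> = x *m u. A finite family v : I -> N of ray generators is fixed and a
   cone is denoted by the set S of indices of its ray generators. Cones are
   rational, so N_Q is used in place of N_R.
   As v is part of the type fan v, two fans X, X' : fan v that both contain all
   the rays [set i] are related by a birational toric map (the identity on the
   torus) that is an isomorphism in codimension one. Strict transform sends the
   prime divisor D_i of X to the prime divisor D_i of X', hence it is the
   identity on torus-invariant divisors, on linear equivalence and on N_1. *)

Section Fans.
Variables (n : nat) (I : finType) (v : I -> 'rV[int]_n).

Definition vQ (i : I) : 'rV[rat]_n := map_mx intr (v i).

Definition in_cone (S : {set I}) (w : 'rV[rat]_n) : Prop :=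
  exists c : I -> rat, (forall i, 0 <= c i) /\ w = \sum_(i in S) c i *: vQ i.

Definition sub_cone (S T : {set I}) : Prop :=
  forall w, in_cone S w -> in_cone T w.

Definition cone_dim (S : {set I}) : nat :=
  \dim (span [seq vQ i | i <- enum S]).

Definition is_face (T S : {set I}) : Prop :=
  exists u : 'cV[rat]_n,
    (forall i, i \in S -> 0 <= (vQ i *m u) 0 0) /\
    T = [set i in S | (vQ i *m u) 0 0 == 0].

(* Not necessarily simplicial. By fan_rays, S consists exactly of the indices
   of the rays of the cone it denotes. *)
Record fan : Type := Fan {
  cones : {set {set I}};
  fan_pointed : forall S, S \in cones -> is_face finset.set0 S;
  fan_rays : forall S i, S \in cones -> i \in S -> is_face [set i] S;
  fan_faces : forall S T, S \in cones -> is_face T S -> T \in cones;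
  fan_meet_face : forall S T, S \in cones -> T \in cones ->
    is_face (S :&: T) S;
  fan_meet : forall S T w, S \in cones -> T \in cones ->
    in_cone S w -> in_cone T w -> in_cone (S :&: T) w
}.

Definition complete_fan (X : fan) : Prop :=
  forall w, exists2 S, S \in cones X & in_cone S w.

(* The generators of every cone are part of a Z-basis (the rows of B) of N. *)
Definition smooth_fan (X : fan) : Prop :=
  forall S, S \in cones X ->
    exists (B : 'M[int]_n) (f : I -> 'I_n),
      [/\ B \in unitmx, {in S &, injective f}
        & {in S, forall i, row (f i) B = v i}].

(* Torus-invariant divisors: D stands for \sum_i D i * D_i. *)
Definition divisor : Type := {ffun I -> int}.

(* Equality of classes in Pic(X) (x) K = K^I / M_K for a smooth X with ray set
   I; div(chi^u) = \sum_i <u, v_i> D_i. *)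
Definition pic_eq (K : numDomainType) (D E : I -> K) : Prop :=
  exists u : 'cV[K]_n, forall i, D i - E i = (map_mx intr (v i) *m u) 0 0.

Definition pic_trivial (D : divisor) : Prop := @pic_eq int D (fun _ => 0).

Definition anticanonical : divisor := [ffun => 1].

(* Strict convexity of the support function of D, for a complete smooth fan:
   its maximal cones are those with n rays. *)
Definition ample (X : fan) (D : divisor) : Prop :=
  forall S, S \in cones X -> #|S| = n ->
    exists u : 'cV[int]_n,
      {in S, forall i, (v i *m u) 0 0 = - D i} /\
      (forall i, i \notin S -> - D i < (v i *m u) 0 0).

Record smooth_projective (X : fan) : Prop := SmoothProjective {
  sp_rays : forall i, [set i] \in cones X;
  sp_smooth : smooth_fan X;
  sp_complete : complete_fan X;
  sp_ample : exists A : divisor, ample X A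
}.

(* N_1(X) with Q-coefficients, the dual of Pic(X) (x) Q, is the space of linear
   relations \sum_i z i * v_i = 0; z i is the intersection number with D_i. *)
Definition one_cycle : Type := {ffun I -> rat}.

Definition dot (D : divisor) (z : one_cycle) : rat :=
  \sum_i (D i)%:~R * z i.

(* z is the class of the invariant curve V(T), T a cone of dimension n - 1:
   if T + i and T + i' are the two maximal cones containing T, it is the
   relation v_i + v_i' + \sum_(j in T) z_j v_j = 0. *)
Definition curve_class (X : fan) (T : {set I}) (z : one_cycle) : Prop :=
  [/\ #|T|.+1 = n, \sum_i z i *: vQ i = 0
    & exists i i' : I,
      [/\ i != i', (i \notin T) && (i' \notin T),
          (i |: T \in cones X) && (i' |: T \in cones X),
          z i = 1 /\ z i' = 1
        & forall j, j \notin i |: (i' |: T) -> z j = 0]].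

(* The Mori cone of a complete toric variety is generated by the classes of the
   torus-invariant curves. *)
Definition mori_cone (X : fan) (z : one_cycle) : Prop :=
  exists (k : nat) (c : 'I_k -> rat) (T : 'I_k -> {set I})
         (C : 'I_k -> one_cycle),
    [/\ forall j, 0 <= c j, forall j, curve_class X (T j) (C j)
      & forall i, z i = \sum_j c j * C j i].

Definition nef (X : fan) (D : divisor) : Prop :=
  forall z, mori_cone X z -> 0 <= dot D z.

Definition in_ray (r z : one_cycle) : Prop :=
  exists2 c : rat, 0 <= c & forall i, z i = c * r i.

(* r spans an extremal ray of the Mori cone. *)
Definition extremal_ray (X : fan) (r : one_cycle) : Prop :=
  [/\ mori_cone X r, r != 0
    & forall z1 z2, mori_cone X z1 -> mori_cone X z2 ->
        in_ray r (z1 + z2) -> in_ray r z1 /\ in_ray r z2].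

(* The identity of N induces a (birational) toric morphism X -> Y. *)
Definition refines (X Y : fan) : Prop :=
  forall S, S \in cones X -> exists2 T, T \in cones Y & sub_cone S T.

(* The orbit of T maps to the orbit of the smallest cone of Y containing T, so
   V(T) maps to a point iff this smallest cone has dimension n. *)
Definition contracted (Y : fan) (T : {set I}) : Prop :=
  forall S, S \in cones Y -> sub_cone T S -> cone_dim S = n.

(* X -> Y is the contraction of the extremal ray spanned by r, and it is small.
   The exceptional locus is the union of the orbit closures V(S), S a cone of X
   that is not a cone of Y; for X simplicial, V(S) has codimension #|S|. *)
Definition small_contraction (X : fan) (r : one_cycle) (Y : fan) : Prop :=
  [/\ extremal_ray X r, refines X Y,
      forall T z, curve_class X T z -> (contracted Y T <-> in_ray r z)
    & forall S, S \in cones X -> S \notin cones Y -> (1 < #|S|)%N].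

Definition elementary_flop (X X' : fan) (r : one_cycle) : Prop :=
  dot anticanonical r = 0 /\
  exists Y : fan, small_contraction X r Y /\ small_contraction X' (- r) Y.

(* h^0(X, O(mD)) >= c m^n for all large m; h^0 counts the characters u in M
   with <u, v_i> >= - m D_i for all i. *)
Definition big (D : divisor) : Prop :=
  exists2 c : rat, 0 < c & exists m0 : nat, forall m : nat, (m0 <= m)%N ->
    exists s : seq 'cV[int]_n,
      [/\ uniq s,
          {in s, forall u i, - (m%:Z * D i) <= (v i *m u) 0 0}
        & c * m%:R ^+ n <= (size s)%:R].

Definition weak_fano (X : fan) : Prop :=
  nef X anticanonical /\ big anticanonical.

Section Gongyo.
Variable R : realType.

Definition tau (K : numDomainType) (emb : K -> R) (X : fan) (D : divisor) :
    \bar R :=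
  ereal_sup [set x | exists (r : nat) (a : 'I_r -> K) (E : 'I_r -> divisor),
    [/\ forall k, 0 < a k,
        forall k, nef X (E k) /\ ~ pic_trivial (E k),
        pic_eq (fun i => (D i)%:~R) (fun i => \sum_k a k * (E k i)%:~R)
      & x = (emb (\sum_k a k))%:E]]%classic.

Definition tauZ : fan -> divisor -> \bar R := tau (fun m : int => m%:~R).
Definition tauQ : fan -> divisor -> \bar R := tau (fun q : rat => ratr q).

(* Both terms are finite when X is smooth projective and 0 <> D is nef. *)
Definition delta (X : fan) (D : divisor) : \bar R := (tauQ X D - tauZ X D)%E.

End Gongyo.
End Fans.

Arguments anticanonical {I}.

(* Main.v *)
Require Import Defs.
From mathcomp Require Import all_boot all_order all_algebra.
From mathcomp Require Import all_classical all_reals ereal.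
From mathcomp Require Import ring lra zify.
Set Implicit Arguments.
Unset Strict Implicit.
Unset Printing Implicit Defensive.
Import Order.TTheory GRing.Theory Num.Theory.
Local Open Scope ring_scope.

(** The flop changes nothing for divisors orthogonal to [r]. In a decomposition
    of a class [D] with [D . r = 0] into nef classes with positive
    coefficients, every summand has nonnegative degree on [r], hence degree
    zero. So once nefness of classes orthogonal to [r] is known to pass from
    [X] to [X'] ([nef_flop]), each decomposition on [X] is one on [X'], and
    conversely, because the inverse of the flop is the flop of [- r]. Hence the
    two suprema agree, for both coefficient rings. The anticanonical class is
    orthogonal to [r] by the definition of a flop.

    Nefness is transferred through the target [Y] of the contraction. For a
    maximal cone [S] of [X] let [u] be the linear function with value [- D_i]
    at [v_i] for [i] in [S]. A nef [D] satisfies [D_k + <u, v_k> >= 0] for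
    all [k] ([nef_support]), and if [D . r = 0] then this is an equality as soon
    as [v_k] lies in the cone of [Y] that contains [S] ([flat_support]): the
    support function of [D] is convex, and linear on the cones of [Y]. Now let
    a wall of [X'] separate the maximal cones [S'] and [i' |: T]. Let [s] be
    the cone of [Y] containing [S'], and choose [S] in [s]. Adding [<u, _>] to
    [D] does not change its degree on the curve of the wall, and all terms
    except that of [i'] then vanish, so the degree is [D_i' + <u, v_i'> >= 0].

    Both support statements are obtained by the simplex method
    ([simplex_ind]). The quantity [D_k + <u, v_k>] is the degree of [D] on the
    relation that expresses [v_k] in the basis [S]. If [v_k] is not in [S], some
    coordinate is negative, and crossing the corresponding wall subtracts a
    positive multiple of the curve class of this wall from the relation. The
    degree of an ample divisor is a natural number that drops at each step, so
    the process ends at a cone that contains [v_k], where the relation is zero.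
    If [v_k] lies in the cone of [Y] containing [S], then every wall that is
    crossed is contracted by [X -> Y], so its class is a multiple of [r], and
    the next cone is in the same cone of [Y]. *)

(** * Evaluation of linear functions *)

Definition ev n (u : 'cV[rat]_n) (x : 'rV[rat]_n) : rat := (x *m u) 0 0.

Section Pairing.
Variable n : nat.
Implicit Types (u : 'cV[rat]_n) (x y : 'rV[rat]_n).

Lemma evD u x y : ev u (x + y) = ev u x + ev u y.
Proof. by rewrite /ev mulmxDl mxE. Qed.

Lemma evN u x : ev u (- x) = - ev u x.
Proof. by rewrite /ev mulNmx mxE. Qed.

Lemma evZ u a x : ev u (a *: x) = a * ev u x.
Proof. by rewrite /ev -scalemxAl mxE. Qed.

Lemma ev0 u : ev u 0 = 0.
Proof. by rewrite /ev mul0mx mxE. Qed.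

Lemma ev_sum u (J : finType) (P : pred J) (c : J -> rat) (w : J -> 'rV[rat]_n) :
  ev u (\sum_(i | P i) c i *: w i) = \sum_(i | P i) c i * ev u (w i).
Proof.
rewrite /ev mulmx_suml summxE; apply: eq_bigr => i _.
by rewrite -scalemxAl mxE.
Qed.

Lemma ev_eq0 u : (forall x, ev u x = 0) -> u = 0.
Proof.
move=> u0; apply/colP => k; have := u0 (delta_mx 0 k).
by rewrite /ev -rowE !mxE.
Qed.

End Pairing.

(** An affine function of [m] that is nonnegative for arbitrarily large [m] has
    nonnegative slope. This replaces the closedness of cones. *)
Lemma ge0_slope (a b : rat) :
  (forall M, exists2 m, (M <= m)%N & 0 <= m%:R * a + b) -> 0 <= a.
Proof.
move=> H; rewrite leNgt; apply/negP => a0.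
have na0 : 0 < - a by rewrite oppr_gt0.
have [m Mm mab] := H (Num.bound `|b / - a|).
have lt1 : b / - a < m%:R.
  apply: le_lt_trans (ler_norm _) _.
  by apply: lt_le_trans (archi_boundP _) _; rewrite ?ler_nat.
move: lt1; rewrite ltr_pdivrMr // => lt1.
by move: mab; lra.
Qed.

Lemma dotN (I : finType) (D : divisor I) (z : one_cycle I) :
  dot D (- z) = - dot D z.
Proof. by rewrite /dot -sumrN; apply: eq_bigr => i _; rewrite ffunE mulrN. Qed.

(** * Smooth cones *)

Section Fan.
Variables (n : nat) (I : finType) (v : I -> 'rV[int]_n).
Local Notation w := (vQ v).

Definition dual_family (S : {set I}) (d : I -> 'cV[int]_n) : Prop :=
  {in S &, forall i j, (v i *m d j) 0 0 = (i == j)%:R}.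

Lemma ev_intr (x : 'rV[int]_n) (u : 'cV[int]_n) :
  ev (map_mx intr u) (map_mx intr x) = ((x *m u) 0 0)%:~R.
Proof. by rewrite /ev -map_mxM mxE. Qed.

Local Notation dQ d i := (map_mx intr (d i)).

Lemma ev_dual S d i j : dual_family S d -> i \in S -> j \in S ->
  ev (dQ d j) (w i) = (i == j)%:R.
Proof. by move=> dS iS jS; rewrite ev_intr dS //; case: eqP. Qed.

Lemma ev_dual_sum S (A : {set I}) d c j : dual_family S d ->
  A \subset S -> j \in S ->
  ev (dQ d j) (\sum_(i in A) c i *: w i) = if j \in A then c j else 0.
Proof.
move=> dS /fintype.subsetP AS jS.
have evE i : i \in A -> ev (dQ d j) (w i) = (i == j)%:R.
  by move=> iA; apply: ev_dual dS (AS i iA) jS.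
rewrite ev_sum; have [jA|jA] := boolP (j \in A); last first.
  rewrite big1 // => i iA; rewrite evE //.
  by case: eqP => [ij|]; rewrite ?mulr0 //; rewrite -ij iA in jA.
rewrite (bigD1 j) //= evE // eqxx mulr1 big1 ?addr0 // => i /andP[iA /negPf ij].
by rewrite evE // ij mulr0.
Qed.

Lemma in_cone_gen (S : {set I}) i : i \in S -> in_cone v S (w i).
Proof.
move=> iS; exists (fun j => (j == i)%:R); split=> [j|]; first exact: ler0n.
rewrite (bigD1 i) //= eqxx scale1r big1 ?addr0 // => j /andP[_ /negPf->].
by rewrite scale0r.
Qed.

Lemma in_cone_sub (A B : {set I}) x :
  A \subset B -> in_cone v A x -> in_cone v B x.
Proof.
move=> /finset.setIidPr AB [c [c0 ->]].
exists (fun i => if i \in A then c i else 0); split=> [i|]; first by case: ifP.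
rewrite [RHS](big_setID A) /= AB [X in _ + X]big1 => [|i].
  by rewrite addr0; apply: eq_bigr => i ->.
by rewrite inE => /andP[/negPf-> _]; rewrite scale0r.
Qed.

Lemma ev_cone_ge0 (S : {set I}) u x : {in S, forall i, 0 <= ev u (w i)} ->
  in_cone v S x -> 0 <= ev u x.
Proof.
move=> u0 [c [c0 ->]]; rewrite ev_sum sumr_ge0 // => i /u0 ui.
by rewrite mulr_ge0.
Qed.

Lemma ev_cone_eq0 (S : {set I}) u x : {in S, forall i, ev u (w i) = 0} ->
  in_cone v S x -> ev u x = 0.
Proof.
by move=> u0 [c [c0 ->]]; rewrite ev_sum big1 // => i /u0 ->; rewrite mulr0.
Qed.


Variable X : fan v.
Hypothesis smX : smooth_fan X.

Lemma smooth_dual S : S \in cones X -> exists2 d : I -> 'cV[int]_n,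
  dual_family S d &
  #|S| = n -> forall x, x = \sum_(i in S) ev (dQ d i) x *: w i.
Proof.
case/smX=> B [f [Bu fi fB]].
exists (fun i => col (f i) (invmx B)) => [i j iS jS|Sn x].
  rewrite colE mulmxA -colE -(fB i iS) -row_mul mulmxV // !mxE.
  by rewrite (inj_in_eq fi).
have fT : [set f i | i in S] = [set: 'I_n].
  apply/eqP; rewrite eqEcard finset.subsetT cardsT card_ord.
  by rewrite card_in_imset // Sn leqnn.
have BV : map_mx intr (invmx B) *m map_mx intr B = 1%:M :> 'M[rat]_n.
  by rewrite -map_mxM mulVmx // map_mx1.
rewrite -{1}(mulmx1 x) -BV mulmxA mulmx_sum_row.
rewrite (eq_bigl (mem [set f i | i in S])) => [|k]; last first.
  by rewrite -[RHS]/(k \in _) fT finset.in_setT.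
rewrite big_imset //=.
apply: eq_bigr => i iS; rewrite -map_row (fB i iS) /vQ; congr (_ *: _).
by rewrite /ev map_col colE mulmxA -colE [RHS]mxE.
Qed.

Lemma smooth_card S : S \in cones X -> (#|S| <= n)%N.
Proof.
case/smX=> B [f [Bu fi fB]].
by rewrite -(card_in_imset fi) (leq_trans (max_card _)) ?card_ord.
Qed.

(** A cone with fewer than [n] rays spans a proper subspace: a vector of the
    basis that extends its generators, and the dual linear function, show it. *)
Lemma exists_off_span S : S \in cones X -> (#|S| < n)%N ->
  exists u x, {in S, forall i, ev u (w i) = 0} /\ ev u x != 0.
Proof.
case/smX=> B [f [Bu fi fB]] Sn.
have /fintype.subsetPn[k _ kS] : ~~ ([set: 'I_n] \subset [set f i | i in S]).
  apply/negP => /subset_leq_card; rewrite cardsT card_ord card_in_imset //.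
  by rewrite leqNgt Sn.
have evB j :
    ev (map_mx intr (col k (invmx B))) (map_mx intr (row j B)) = (j == k)%:R.
  by rewrite ev_intr colE mulmxA -colE -row_mul mulmxV // !mxE; case: eqP.
exists (map_mx intr (col k (invmx B))), (map_mx intr (row k B)).
split=> [i iS|].
  rewrite /vQ -(fB i iS) evB; case: eqP => // fk.
  by case/negP: kS; rewrite -fk imset_f.
by rewrite evB eqxx oner_eq0.
Qed.

Lemma functional_eq0 S u : S \in cones X -> #|S| = n ->
  {in S, forall i, ev u (w i) = 0} -> u = 0.
Proof.
move=> /smooth_dual[d dS expS] /expS expand u0; apply: ev_eq0 => x.
by rewrite (expand x) ev_sum big1 // => i /u0 ->; rewrite mulr0.
Qed.

Lemma facet_cone S j : S \in cones X -> j \in S -> S :\ j \in cones X.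
Proof.
move=> SX jS; have [d dS _] := smooth_dual SX.
apply: (fan_faces SX); exists (dQ d j).
have dE i : i \in S -> (w i *m dQ d j) 0 0 = (i == j)%:R.
  by move=> iS; apply: (ev_dual dS iS jS).
split=> [i iS|]; first by rewrite dE.
apply/setP => i; rewrite !inE.
case: (boolP (i \in S)) => iS; rewrite ?andbF //=.
by rewrite dE // andbT pnatr_eq0 eqb0.
Qed.

(** * Complete fans: stars, maximal cones and walls *)

Hypothesis cX : complete_fan X.

(** There are finitely many cones, so one of them returns infinitely often. *)
Lemma recurrent_cone p b : exists2 S, S \in cones X &
  forall M, exists2 m, (M <= m)%N & in_cone v S (m%:R *: p + b).
Proof.
apply: contrapT => noS.
have H S : exists M, forall m, (M <= m)%N -> S \in cones X ->
    ~ in_cone v S (m%:R *: p + b).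
  apply: contrapT => noM; case: (boolP (S \in cones X)) => SX; last first.
    by apply: noM; exists 0%N => m _; rewrite (negPf SX).
  apply: noS; exists S => // M; apply: contrapT => noM'; apply: noM.
  by exists M => m Mm _ mS; apply: noM'; exists m.
pose M S := projT1 (cid (H S)).
have [S SX] := cX ((\max_S M S)%:R *: p + b).
by apply: (projT2 (cid (H S))) => //; apply: leq_bigmax.
Qed.

(** The star of a cone [S0] is complete modulo the span of [S0]. Moving from [b]
    in the direction of an interior point [p] of [S0], one returns to some cone
    [S] infinitely often. Then [p] and [b] are in the span of [S]; comparing
    slopes, [p] is in [S], so [S0] is a face of [S]; and the coordinates of [b]
    in the directions outside [S0] are those of the points [m p + b]. *)
Lemma star_complete S0 b : S0 \in cones X -> exists S c,
  [/\ S \in cones X, S0 \subset S, b = \sum_(i in S) c i *: w i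
    & forall i, i \in S -> i \notin S0 -> 0 <= c i].
Proof.
move=> S0X; pose p := \sum_(i in S0) 1 *: w i.
have [S SX rec] := recurrent_cone p b.
have [d dS _] := smooth_dual SX.
pose L x := x - \sum_(i in S) ev (dQ d i) x *: w i.
have L0 x : in_cone v S x -> L x = 0.
  case=> c [c0 xE]; rewrite /L {1}xE; apply/eqP; rewrite subr_eq0; apply/eqP.
  by apply: eq_bigr => i iS; rewrite xE (ev_dual_sum _ dS) ?iS.
have LD m x y : L (m *: x + y) = m *: L x + L y.
  rewrite /L scalerBr scaler_sumr addrACA -opprD -big_split.
  congr (_ - _) => /=.
  by apply: eq_bigr => i _; rewrite evD evZ scalerDl scalerA.
have [m1 _ /L0] := rec 0%N; rewrite LD => L1.
have [m2 m12 /L0] := rec m1.+1; rewrite LD => L2.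
have Lp : L p = 0.
  have : (m2%:R - m1%:R) *: L p = 0.
    by rewrite scalerBl -[RHS](subrr 0) -{1}L2 -L1 opprD addrACA subrr addr0.
  move/eqP; rewrite scaler_eq0 subr_eq0 eqr_nat => /orP[/eqP m21|/eqP//].
  by rewrite m21 ltnn in m12.
have Lb : L b = 0 by move: L1; rewrite Lp scaler0 add0r.
have ev_ge0 i M : i \in S -> exists2 m, (M <= m)%N &
    0 <= m%:R * ev (dQ d i) p + ev (dQ d i) b.
  move=> iS; have [m Mm mS] := rec M; exists m => //; rewrite -evZ -evD.
  by apply: ev_cone_ge0 mS => j jS; rewrite (ev_dual dS).
have pS : in_cone v S p.
  exists (fun i => if i \in S then ev (dQ d i) p else 0); split=> [i|].
    by case: ifP => // iS; apply: ge0_slope (fun M => ev_ge0 i M iS).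
  move/eqP: Lp; rewrite subr_eq0 => /eqP {1}->.
  by apply: eq_bigr => i ->.
have pS0 : in_cone v S0 p by exists (fun=> 1); split=> // i; apply: ler01.
have [c [_ pE]] := fan_meet S0X SX pS0 pS.
have [d0 dS0 _] := smooth_dual S0X.
have S0S : S0 \subset S.
  apply/fintype.subsetP => i iS0.
  have : ev (dQ d0 i) p = 1 by rewrite (ev_dual_sum _ dS0) ?iS0.
  rewrite pE (ev_dual_sum _ dS0) ?finset.subsetIl // inE iS0 /=.
  by case: ifP => // _ /esym/eqP; rewrite oner_eq0.
exists S, (fun i => ev (dQ d i) b); split=> //.
  by move/eqP: Lb; rewrite subr_eq0 => /eqP.
move=> i iS /negPf iS0; have [m _] := ev_ge0 i 0%N iS.
by rewrite (ev_dual_sum _ dS) // iS0 mulr0 add0r.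
Qed.

Lemma extend_to_maximal S0 : S0 \in cones X ->
  exists S, [/\ S \in cones X, #|S| = n & S0 \subset S].
Proof.
have [k] := ubnP (n - #|S0|); elim: k S0 => // k IH S0 kS0 S0X.
have [S0n|nS0] := ltnP #|S0| n; last first.
  by exists S0; split=> //; apply/eqP; rewrite eqn_leq smooth_card.
have [u [x [u0 ux]]] := exists_off_span S0X S0n.
have [S1 [c [S1X S01 xE _]]] := star_complete x S0X.
have neS : S0 != S1.
  apply: contraNneq ux => S0E; rewrite xE ev_sum big1 // => i.
  by rewrite -S0E => /u0 ->; rewrite mulr0.
have S01c : (#|S0| < #|S1|)%N.
  by apply: proper_card; rewrite finset.properEneq neS.
have [|S [SX Sn S1S]] := IH S1 _ S1X.
  by rewrite -ltnS; apply: leq_ltn_trans kS0; apply: ltn_sub2l.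
by exists S; split=> //; apply: fintype.subset_trans S1S.
Qed.

(** The cone on the other side of the facet opposite to [v_j] is found in the
    star of that facet, in the direction [- v_j]. Smoothness of both cones makes
    the coefficients of [v_j] and [v_i'] in the wall relation equal. *)
Lemma wall_crossing S j : S \in cones X -> #|S| = n -> j \in S ->
  exists i' (C : one_cycle I),
  [/\ i' \notin S, i' |: (S :\ j) \in cones X, curve_class X (S :\ j) C,
      C j = 1 & forall i, i \notin S -> C i = (i == i')%:R].
Proof.
move=> SX Sn jS; set T := S :\ j; have TX := facet_cone SX jS.
have jT : j \notin T by rewrite !inE eqxx.
have TS : T \subset S := subD1set _ _.
have jTS : j |: T = S by rewrite finset.setD1K.
have [S1 [c [S1X TS1 jE c0]]] := star_complete (- w j) TX.
have [d dS _] := smooth_dual SX; have [d1 dS1 _] := smooth_dual S1X.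
have Tcard : #|T|.+1 = n by rewrite -Sn (cardsD1 j S) jS.
have jS1 : j \notin S1.
  apply/negP => jS1; have := c0 j jS1 jT.
  have <- : ev (dQ d1 j) (- w j) = c j by rewrite jE (ev_dual_sum _ dS1) ?jS1.
  by rewrite evN (ev_dual dS1) // eqxx oppr_ge0 ler10.
have [i' i'S1 i'T] : exists2 i', i' \in S1 & i' \notin T.
  apply/fintype.subsetPn/negP => S1T.
  have : ev (dQ d j) (- w j) = 0.
    rewrite jE (ev_dual_sum _ dS) ?(negPf jS1) //.
    exact: fintype.subset_trans S1T TS.
  by rewrite evN (ev_dual dS) // eqxx => /eqP; rewrite oppr_eq0 oner_eq0.
have i'j : i' != j by apply: contraNneq jS1 => <-.
have S1E : i' |: T = S1.
  apply/eqP; rewrite eqEcard finset.subUset finset.sub1set i'S1 TS1 /=.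
  by rewrite cardsU1 i'T add1n Tcard smooth_card.
(* Both c i' and its inverse are integers, as each of the two cones is part
   of a lattice basis. *)
have ci' : c i' = 1.
  have c_int : c i' = (- (v j *m d1 i') 0 0)%:~R.
    by rewrite intrN -ev_intr -evN jE (ev_dual_sum _ dS1) ?i'S1.
  have : ev (dQ d j) (- w j) = c i' * ((v i' *m d j) 0 0)%:~R.
    rewrite jE -S1E big_setU1 //= evD evZ (ev_dual_sum _ dS) // (negPf jT).
    by rewrite addr0 ev_intr.
  have := c0 i' i'S1 i'T.
  rewrite evN (ev_dual dS) // eqxx c_int.
  move: (- (v j *m _) 0 0) ((v i' *m _) 0 0) => a b.
  rewrite mulr1n (_ : -1 = (-1)%:~R :> rat) //.
  rewrite ler0z -intrM => a0 /intr_inj ab.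
  have : (`|a| * `|b|)%N == 1%N by rewrite -abszM -ab.
  by rewrite muln_eq1 => /andP[/eqP a1 _]; rewrite -(gez0_abs a0) a1.
pose C : one_cycle I :=
  [ffun i => if i == j then 1 else if i \in S1 then c i else 0].
have Cj : C j = 1 by rewrite ffunE eqxx.
have Ci' : C i' = 1 by rewrite ffunE (negPf i'j) i'S1.
exists i', C; split=> //.
- by move: i'T; rewrite !inE negb_and i'j.
- by rewrite S1E.
- split=> //.
    rewrite (bigD1 j) //= Cj scale1r (bigID (mem S1)) /= [X in _ + (_ + X)]big1.
      rewrite addr0 (_ : \sum_(i | _) _ = - w j) ?subrr // jE.
      apply: congr_big => // i; last first.
        by case/andP=> /negPf ij iS1; rewrite ffunE ij iS1.
      by rewrite andb_idl // => iS1; apply: contraNneq jS1 => <-.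
    by move=> i /andP[/negPf ij /negPf iS1]; rewrite ffunE ij iS1 scale0r.
  exists j, i'; split=> //; rewrite ?jT ?i'T ?jTS ?S1E ?SX ?S1X //.
    by rewrite eq_sym.
  move=> i; rewrite !inE negb_or ffunE => /andP[/negPf-> /negPf->] //.
- move=> i iS; have ij : i == j = false by apply: contraNF iS => /eqP->.
  have iT : i \notin T by apply: contraNN iS; apply: (fintype.subsetP TS).
  rewrite ffunE ij -S1E in_setU1 (negPf iT) orbF.
  by case: eqP => // ->.
Qed.


(** * The simplex method *)

Lemma ray_in_cone S k : [set k] \in cones X -> S \in cones X ->
  in_cone v S (w k) -> k \in S.
Proof.
move=> kX SX kS; apply/negPn/negP => knS.
have [d dk _] := smooth_dual kX.
have kk : k \in [set k] by rewrite finset.set11.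
have [c [_ kE]] := fan_meet SX kX kS (in_cone_gen kk).
have := ev_dual dk kk kk; rewrite kE (ev_dual_sum _ dk) ?finset.subsetIr //.
by rewrite inE (negPf knS) eqxx => /eqP; rewrite eq_sym oner_eq0.
Qed.

(** For a maximal cone [S], this is the relation [v_k - (its expansion in the
    basis S) = 0]; it is zero if [k] is in [S]. *)
Definition expansion (S : {set I}) (k : I) (z : one_cycle I) : Prop :=
  \sum_i z i *: w i = 0 /\ forall i, i \notin S -> z i = (i == k)%:R.

(** The principal divisor of [u] has degree [<u, sum_i z_i v_i> = 0] on [z]. *)
Lemma dot_shift D (z : one_cycle I) u : \sum_i z i *: w i = 0 ->
  dot D z = \sum_i z i * ((D i)%:~R + ev u (w i)).
Proof.
move=> z0; have evz0 : \sum_i z i * ev u (w i) = 0 by rewrite -ev_sum z0 ev0.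
rewrite -[LHS]addr0 -[X in _ + X]evz0 /dot -big_split.
by apply: eq_bigr => i _; rewrite mulrDr mulrC.
Qed.

Lemma dot_expansion S k z (D : divisor I) u : expansion S k z ->
  {in S, forall i, (D i)%:~R + ev u (w i) = 0} ->
  dot D z = (D k)%:~R + ev u (w k).
Proof.
move=> [z0 zS] uS; rewrite (dot_shift D u z0) (bigD1 k) //=.
rewrite big1 => [|i /negPf ik].
  rewrite addr0; have [/uS ->|/zS ->] := boolP (k \in S); first exact: mulr0.
  by rewrite eqxx mul1r.
have [/uS ->|/zS ->] := boolP (i \in S); first exact: mulr0.
by rewrite ik mul0r.
Qed.

Lemma exists_expansion S k : S \in cones X -> #|S| = n ->
  exists z, expansion S k z.
Proof.
move=> SX Sn; have [d dS /(_ Sn) expand] := smooth_dual SX.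
exists [ffun i => (i == k)%:R - (if i \in S then ev (dQ d i) (w k) else 0)].
split=> [|i /negPf iS]; last by rewrite ffunE iS subr0.
under eq_bigr do rewrite ffunE scalerBl.
rewrite sumrB (bigD1 k) //= eqxx scale1r big1 => [|i /negPf->]; last first.
  exact: scale0r.
rewrite addr0 [X in X - _](expand (w k)).
apply/eqP; rewrite subr_eq0; apply/eqP.
rewrite big_mkcond; apply: eq_bigr => i _.
by case: ifP => // _; rewrite scale0r.
Qed.

Lemma exists_support S (D : divisor I) : S \in cones X ->
  exists u, {in S, forall i, (D i)%:~R + ev u (w i) = 0}.
Proof.
move=> SX; have [d dS _] := smooth_dual SX.
exists (map_mx intr (- \sum_(i in S) D i *: d i)) => i iS.
rewrite ev_intr mulmxN mulmx_sumr mxE summxE (bigD1 i) //=.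
rewrite -scalemxAr mxE dS // eqxx mulr1 big1 => [|j /andP[jS /negPf ji]].
  by rewrite addr0 intrN subrr.
by rewrite -scalemxAr mxE dS // eq_sym ji mulr0.
Qed.

Lemma ample_expansion A S k z : ample X A -> S \in cones X -> #|S| = n ->
  expansion S k z ->
  exists m : nat, dot A z = m%:R /\ (k \notin S -> (0 < m)%N).
Proof.
move=> amA SX Sn zS; have [u [uS unS]] := amA S SX Sn.
have -> : dot A z = (A k + (v k *m u) 0 0)%:~R.
  rewrite intrD -ev_intr; apply: dot_expansion zS _ => i iS.
  by rewrite ev_intr uS // intrN subrr.
have [kS|kS] := boolP (k \in S); first by exists 0%N; rewrite uS ?subrr.
have := unS k kS; move: (A k) ((v k *m u) 0 0) => a b ab.
exists `|(a + b)%R|%N; split=> [|_]; last by lia.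
by rewrite [RHS]pmulrn gez0_abs //; lia.
Qed.

Hypothesis rX : forall i, [set i] \in cones X.
Variable A : divisor I.
Hypothesis amA : ample X A.

(** [Q] is a property of the cones met on the way, kept at each crossing; it
    restricts the walls for which the degree [dot D C] has to be controlled. *)
Lemma simplex_ind (D : divisor I) (k : I)
    (Q : {set I} -> Prop) (P : rat -> Prop) :
  P 0 -> (forall x y a, 0 < a -> P x -> P y -> P (y + a * x)) ->
  (forall S j i' z C, S \in cones X -> #|S| = n -> Q S -> j \in S ->
     expansion S k z -> 0 < z j ->
     i' |: (S :\ j) \in cones X -> curve_class X (S :\ j) C ->
     P (dot D C) /\ Q (i' |: (S :\ j))) ->
  forall S z, S \in cones X -> #|S| = n -> Q S -> expansion S k z ->
    P (dot D z).
Proof.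
move=> P0 PD cross S z SX Sn QS zS.
have [m [Am _]] := ample_expansion amA SX Sn zS.
elim/ltn_ind: m S z SX Sn QS zS Am => m IH S z SX Sn QS zS Am.
have [z0 zk] := zS; have [kS|kS] := boolP (k \in S).
  have [u uS] := exists_support D SX.
  by rewrite (dot_expansion zS uS) uS.
have [/existsP[j /andP[jS zj]]|] := boolP [exists j, (j \in S) && (0 < z j)];
  last first.
  rewrite negb_exists => /forallP zle0.
  (* All coordinates of v_k in the basis S are nonnegative: v_k lies in S. *)
  case/negP: (kS); apply: ray_in_cone => //.
  exists (fun i => if i \in S then - z i else 0); split=> [i|].
    case: ifP => // iS; have := zle0 i.
    by rewrite iS /= -leNgt oppr_ge0.
  have: \sum_i z i *: w i = w k + \sum_(i in S) z i *: w i.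
    rewrite (bigID (mem S)) /= addrC; congr (_ + _).
    rewrite (bigD1 k) //= zk // eqxx scale1r big1 ?addr0 //.
    by move=> i /andP[iS /negPf ik]; rewrite zk // ik scale0r.
  rewrite z0 => /esym/eqP; rewrite addr_eq0 => /eqP ->; rewrite -sumrN.
  by apply: eq_bigr => i ->; rewrite scaleNr.
have [i' [C [i'S S1X CT Cj CS]]] := wall_crossing SX Sn jS.
have [PC QS1] := cross _ _ _ _ _ SX Sn QS jS zS zj S1X CT.
have [Tn C0 _] := CT.
have S1n : #|i' |: (S :\ j)| = n.
  by rewrite cardsU1 !inE (negPf i'S) andbF.
pose z1 : one_cycle I := [ffun i => z i - z j * C i].
have dotE E : dot E z = dot E z1 + z j * dot E C.
  rewrite /dot mulr_sumr -big_split; apply: eq_bigr => i _ /=.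
  by rewrite ffunE; ring.
have z1S : expansion (i' |: (S :\ j)) k z1.
  split=> [|i].
    under eq_bigr do rewrite ffunE scalerBl -scalerA.
    by rewrite sumrB -scaler_sumr z0 C0 scaler0 subr0.
  rewrite !inE negb_or negb_and negbK ffunE => /andP[/negPf ii'].
  case/orP=> [/eqP->|iS].
    by rewrite Cj mulr1 subrr; case: eqP kS => // <-; rewrite jS.
  by rewrite CS // ii' mulr0 subr0 zk.
have [m1 [Am1 _]] := ample_expansion amA S1X S1n z1S.
(* The curve class C is itself the expansion of v_i' in the basis S. *)
have [mC [AC /(_ i'S) mC0]] := ample_expansion amA SX Sn (conj C0 CS).
have m1m : (m1 < m)%N.
  by rewrite -(ltr_nat rat) -Am1 -Am dotE ltrDl AC mulr_gt0 // ltr0n.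
rewrite dotE; apply: PD => //; exact: (IH m1 m1m _ z1 S1X S1n QS1 z1S Am1).
Qed.

Lemma curve_mori T C : curve_class X T C -> mori_cone X C.
Proof.
move=> CT; exists 1%N, (fun=> 1), (fun=> T), (fun=> C); split=> // i.
by rewrite big_ord1 mul1r.
Qed.

(** A locally convex support function is globally convex: the tangent linear
    function on one maximal cone bounds it everywhere. *)
Lemma nef_support (D : divisor I) S u : nef X D -> S \in cones X -> #|S| = n ->
  {in S, forall i, (D i)%:~R + ev u (w i) = 0} ->
  forall k, 0 <= (D k)%:~R + ev u (w k).
Proof.
move=> nefD SX Sn uS k; have [z zS] := exists_expansion k SX Sn.
rewrite -(dot_expansion zS uS).
apply: (@simplex_ind D k (fun=> True) (fun x => 0 <= x)) zS => //.
  by move=> x y a a0 x0 y0; rewrite addr_ge0 // mulr_ge0 // ltW.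
by move=> S' j i' z' C *; split=> //; apply/nefD/curve_mori; eassumption.
Qed.

(** * Passage to a coarser fan *)

(** The second condition excludes every supporting hyperplane at [p], so [p] is
    an interior point in the topological sense and the cone has dimension [n].
    This form applies directly to the functions that define faces. *)
Definition interior_point (s : {set I}) (p : 'rV[rat]_n) : Prop :=
  in_cone v s p /\ forall u, (forall x, in_cone v s x -> 0 <= ev u x) ->
    ev u p = 0 -> u = 0.

(** The common face of [s] and [t] contains an interior point of [s]. The
    function that cuts it out on [s] vanishes at this point, hence is zero, and
    the face is all of [s]. So [s] is contained in [t]; the function that cuts
    the face out on [t] is then nonnegative on [s] as well, hence zero for the
    same reason, and the face is all of [t]. *)
Lemma cone_of_interior_point (Y : fan v) s t p :
  s \in cones Y -> t \in cones Y ->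
  interior_point s p -> in_cone v t p -> s = t.
Proof.
move=> sY tY [ps pint] pt.
have face_full a b : a \in cones Y -> b \in cones Y -> in_cone v a p ->
    in_cone v b p -> (forall x, in_cone v s x -> in_cone v a x) -> a \subset b.
  move=> aY bY pa pb sa; have [u [u0 /setP abE]] := fan_meet_face aY bY.
  have uI : {in a :&: b, forall i, ev u (w i) = 0}.
    by move=> i; rewrite abE !inE => /andP[_ /eqP].
  have uE : u = 0.
    apply: pint (ev_cone_eq0 uI (fan_meet aY bY pa pb)) => x /sa.
    exact: ev_cone_ge0.
  apply/fintype.subsetP => i ia; have := abE i.
  by rewrite !inE ia uE mulmx0 mxE eqxx.
have st := face_full s t sY tY ps pt (fun _ => id).
apply/eqP; rewrite finset.eqEsubset st face_full // => x.
exact: in_cone_sub.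
Qed.

Lemma full_cone_dim S s : S \in cones X -> #|S| = n -> sub_cone v S s ->
  cone_dim v s = n.
Proof.
move=> SX Sn Ss; have [d dS /(_ Sn) expand] := smooth_dual SX.
suff -> : cone_dim v s = \dim (fullv : {vspace 'rV[rat]_n}).
  by rewrite dimvf /dim /= mul1n.
congr (\dim _); apply/eqP; rewrite eqEsubv subvf; apply/subvP => x _.
rewrite (expand x).
apply: memv_suml => i iS; apply: memvZ.
have [c [_ ->]] := Ss _ (in_cone_gen iS).
apply: memv_suml => j js; apply/memvZ/memv_span.
by apply: map_f; rewrite mem_enum.
Qed.

Lemma maximal_interior S s : S \in cones X -> #|S| = n -> sub_cone v S s ->
  interior_point s (\sum_(i in S) 1 *: w i).
Proof.
move=> SX Sn Ss; split.
  by apply: Ss; exists (fun=> 1); split=> // i; apply: ler01.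
move=> u u0; rewrite ev_sum => /eqP.
rewrite psumr_eq0 => [/allP us|i iS]; last first.
  by rewrite mul1r u0 //; apply/Ss/in_cone_gen.
apply: (functional_eq0 SX Sn) => i iS.
by have := us i (mem_index_enum i); rewrite iS mul1r => /eqP.
Qed.

Section Contraction.
Variables (Y : fan v) (r : one_cycle I).
Hypothesis XY : refines X Y.
Hypothesis contr :
  forall T C, curve_class X T C -> contracted Y T -> in_ray r C.

(** The walls crossed on the way from [S] to [v_k] are in the interior of [s].
    Indeed, let a linear function be nonnegative on [s] and vanish on the wall
    opposite to [v_j]. Evaluated on the relation between [v_k] and [S], it gives
    a vanishing sum of nonnegative terms, one of them a positive multiple of
    its value at [v_j]; so it vanishes on the basis [S]. Hence [s] is the only
    cone of [Y] that contains the wall, which is therefore contracted. *)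
Lemma flat_support (D : divisor I) S s u :
  dot D r = 0 -> S \in cones X -> #|S| = n -> s \in cones Y -> sub_cone v S s ->
  {in S, forall i, (D i)%:~R + ev u (w i) = 0} ->
  forall k, in_cone v s (w k) -> (D k)%:~R + ev u (w k) = 0.
Proof.
move=> Dr SX Sn sY Ss uS k ks; have [z zS] := exists_expansion k SX Sn.
rewrite -(dot_expansion zS uS).
apply: (@simplex_ind D k (fun S => sub_cone v S s) (fun x => x = 0)) zS => //.
  by move=> x y a _ -> ->; rewrite mulr0 addr0.
move=> {u SX Sn Ss uS} {}S j i' {}z C SX Sn Ss jS [z0 zk] zj S1X CT.
pose p := \sum_(i in S :\ j) 1 *: w i.
have pT : in_cone v (S :\ j) p by exists (fun=> 1); split=> // i; apply: ler01.
have TS x : in_cone v (S :\ j) x -> in_cone v S x.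
  exact/in_cone_sub/subD1set.
have pint : interior_point s p.
  split=> [|u u0]; first exact/Ss/TS.
  rewrite ev_sum => /eqP; rewrite psumr_eq0 => [/allP us|i iT]; last first.
    by rewrite mul1r u0 //; apply/Ss/TS/in_cone_gen.
  have uT i : i \in S -> i != j -> ev u (w i) = 0.
    move=> iS ij; have := us i (mem_index_enum i).
    by rewrite !inE iS ij mul1r => /eqP.
  apply: (functional_eq0 SX Sn) => i iS.
  have [->|/uT->//] := eqVneq i j.
  have : \sum_i z i * ev u (w i) = 0 by rewrite -ev_sum z0 ev0.
  move/eqP; rewrite psumr_eq0 => [/allP/(_ j (mem_index_enum j))/=|l _].
    by rewrite mulf_eq0 gt_eqF // => /eqP.
  have [lS|/zk->] := boolP (l \in S); last first.
    by case: eqP => [->|_]; rewrite ?mul0r // mul1r u0.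
  have [->|/(uT l lS) ->] := eqVneq l j; last by rewrite mulr0.
  by apply: mulr_ge0; [apply: ltW | apply/u0/Ss/in_cone_gen].
have TY t : t \in cones Y -> sub_cone v (S :\ j) t -> t = s.
  move=> tY Tt; apply/esym.
  exact: (cone_of_interior_point sY tY pint (Tt _ pT)).
have [|c _ CE] := contr CT.
  by move=> t tY /(TY _ tY) ->; apply: full_cone_dim Ss.
split.
  rewrite /dot; under eq_bigr do rewrite CE mulrCA.
  by rewrite -mulr_sumr -/(dot D r) Dr mulr0.
have [t tY S1t] := XY S1X; have <- // : t = s.
by apply: TY => // x xT; apply/S1t/(in_cone_sub _ xT)/finset.subsetUr.
Qed.

End Contraction.
End Fan.

(** * Flops *)

Lemma nef_transfer n (I : finType) (v : I -> 'rV[int]_n) (X X' Y : fan v)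
    (r : one_cycle I) (D : divisor I) :
  smooth_projective X -> smooth_fan X' -> refines X Y -> refines X' Y ->
  (forall T C, curve_class X T C -> contracted Y T -> in_ray r C) ->
  nef X D -> dot D r = 0 -> nef X' D.
Proof.
case=> rX smX cX [A amA] smX' XY X'Y contr nefD Dr z [m [c [T [C [c0 CT zE]]]]].
have -> : dot D z = \sum_j c j * dot D (C j).
  rewrite /dot; under eq_bigr do rewrite zE mulr_sumr.
  rewrite exchange_big /=; apply: eq_bigr => j _; rewrite mulr_sumr.
  by apply: eq_bigr => i _; rewrite mulrCA.
apply: sumr_ge0 => j _; apply: mulr_ge0 => //.
have [Tn C0 [i [i' [_ /andP[iT _] /andP[S'X' _] [_ Ci'] Csupp]]]] := CT j.
set S' := i |: T j in S'X'; have S'n : #|S'| = n by rewrite cardsU1 iT.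
have [s sY S's] := X'Y _ S'X'.
have sint := maximal_interior smX' S'X' S'n S's.
(* A maximal cone S of X inside s: one that contains an interior point of s. *)
have [S0 S0X pS0] := cX (\sum_(i in S') 1 *: vQ v i).
have [S [SX Sn S0S]] := extend_to_maximal smX cX S0X.
have [t tY St] := XY _ SX.
have st : s = t.
  apply: (cone_of_interior_point sY tY sint).
  exact/St/(in_cone_sub S0S).
rewrite -st in St.
have [u uS] := exists_support smX D SX.
have [ge0 eq0] := (nef_support smX cX rX amA nefD SX Sn uS,
  flat_support smX cX rX amA XY contr Dr SX Sn sY St uS).
rewrite (dot_shift D u C0); apply: sumr_ge0 => k _.
have [kS'|kS'] := boolP (k \in S').
  by rewrite eq0 ?mulr0 //; apply/S's/in_cone_gen.
have [->|ki'] := eqVneq k i'; first by rewrite Ci' mul1r.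
rewrite Csupp ?mul0r //; move: kS'; rewrite !inE !negb_or => /andP[-> ->].
by rewrite ki'.
Qed.

Lemma mori_relation n (I : finType) (v : I -> 'rV[int]_n) (X : fan v) z :
  mori_cone X z -> \sum_i z i *: vQ v i = 0.
Proof.
case=> m [c [T [C [_ CT zE]]]]; under eq_bigr do rewrite zE scaler_suml.
rewrite exchange_big big1 // => j _ /=; under eq_bigr do rewrite -scalerA.
by have [_ C0 _] := CT j; rewrite -scaler_sumr C0 scaler0.
Qed.

Lemma elementary_flopC n (I : finType) (v : I -> 'rV[int]_n) (X X' : fan v) r :
  elementary_flop X X' r -> elementary_flop X' X (- r).
Proof.
case=> Kr [Y [XY X'Y]]; split; last by exists Y; rewrite opprK.
by rewrite dotN Kr oppr0.
Qed.

Lemma nef_flop n (I : finType) (v : I -> 'rV[int]_n) (X X' : fan v) r D :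
  smooth_projective X -> smooth_projective X' -> elementary_flop X X' r ->
  nef X D -> dot D r = 0 -> nef X' D.
Proof.
move=> spX [_ smX' _ _] [_ [Y [[_ XY contr _] [_ X'Y _ _]]]].
by apply: nef_transfer spX smX' XY X'Y _ => T C /contr[].
Qed.

(** Principal divisors have degree zero on the relation [r]. The morphism [g]
    treats integral and rational coefficients together. *)
Lemma pic_eq_dot (K : numDomainType) (g : {rmorphism K -> rat}) n (I : finType)
    (v : I -> 'rV[int]_n) (D : divisor I) (r : one_cycle I)
    (J : finType) (a : J -> K) (E : J -> divisor I) :
  \sum_i r i *: vQ v i = 0 ->
  pic_eq v (fun i => (D i)%:~R) (fun i => \sum_k a k * (E k i)%:~R) ->
  dot D r = \sum_k g (a k) * dot (E k) r.
Proof.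
move=> r0 [u uE].
have -> : \sum_k g (a k) * dot (E k) r =
          \sum_i (\sum_k g (a k) * (E k i)%:~R) * r i.
  under eq_bigr do rewrite /dot mulr_sumr.
  rewrite exchange_big; apply: eq_bigr => i _; rewrite mulr_suml.
  by apply: eq_bigr => k _; rewrite mulrA.
have wE i : vQ v i = map_mx g (map_mx intr (v i)).
  by apply/rowP => l; rewrite !mxE rmorph_int.
have evE i :
    (D i)%:~R - \sum_k g (a k) * (E k i)%:~R = ev (map_mx g u) (vQ v i).
  rewrite wE /ev -map_mxM mxE -uE rmorphB rmorph_int rmorph_sum; congr (_ - _).
  by apply: eq_bigr => k _; rewrite rmorphM rmorph_int.
apply/eqP; rewrite -subr_eq0 /dot -sumrB.
under eq_bigr do rewrite -mulrBl evE mulrC.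
by rewrite -ev_sum r0 ev0.
Qed.

(** The degree of [D] on [r] is zero and is a positive combination of the
    nonnegative degrees of the summands, so all of these are orthogonal to
    [r] and remain nef. *)
Lemma tau_le (R : realType) (K : numDomainType) (g : {rmorphism K -> rat})
    (emb : K -> R) n (I : finType) (v : I -> 'rV[int]_n) (X X' : fan v) r D :
  (forall a, 0 < a -> 0 < g a) ->
  smooth_projective X -> smooth_projective X' -> elementary_flop X X' r ->
  dot D r = 0 -> (tau emb X D <= tau emb X' D)%E.
Proof.
move=> g0 spX spX' flop Dr; have [_ [Y [[[rX _ _] _ _ _] _]]] := flop.
apply: le_ereal_sup => x [m [a [E [a0 nefE DE ->]]]].
exists m, a, E; split=> // k; have [nefk ?] := nefE k; split=> //.
apply: (nef_flop spX spX' flop nefk).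
have := pic_eq_dot g (mori_relation rX) DE; rewrite Dr => /esym/eqP.
rewrite psumr_eq0 => [/allP/(_ k (mem_index_enum k))/=|l _].
  by rewrite mulf_eq0 gt_eqF ?g0 // => /eqP.
by rewrite mulr_ge0 ?(ltW (g0 _ _)) //; apply: (proj1 (nefE l)).
Qed.

Lemma tau_flop (R : realType) (K : numDomainType) (g : {rmorphism K -> rat})
    (emb : K -> R) n (I : finType) (v : I -> 'rV[int]_n) (X X' : fan v) r D :
  (forall a, 0 < a -> 0 < g a) ->
  smooth_projective X -> smooth_projective X' -> elementary_flop X X' r ->
  dot D r = 0 -> tau emb X D = tau emb X' D.
Proof.
move=> g0 spX spX' flop Dr; apply/le_anti/andP; split.
  exact: tau_le g0 spX spX' flop Dr.
apply: tau_le g0 spX' spX (elementary_flopC flop) _.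
by rewrite dotN Dr oppr0.
Qed.

Theorem proposition2p11 (R : realType) (n : nat) (I : finType)
    (v : I -> 'rV[int]_n) (X X' : fan v) (r : one_cycle I)
    (hX : smooth_projective X) (hX' : smooth_projective X')
    (hflop : elementary_flop X X' r) :
  (forall D : divisor I,
     ~ pic_trivial v D -> nef X D -> dot D r = 0 ->
     [/\ nef X' D, tauZ R X D = tauZ R X' D & tauQ R X D = tauQ R X' D])
  /\
  (weak_fano X -> weak_fano X' ->
     [/\ tauZ R X anticanonical = tauZ R X' anticanonical,
         tauQ R X anticanonical = tauQ R X' anticanonical
       & delta R X anticanonical = delta R X' anticanonical]).
Proof.
have tauE D : dot D r = 0 ->
    tauZ R X D = tauZ R X' D /\ tauQ R X D = tauQ R X' D.
  move=> Dr; split.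
    by apply: (@tau_flop _ _ intr) Dr => // a; rewrite ltr0z.
  by apply: (@tau_flop _ _ idfun) Dr.
split=> [D _ nefD Dr|_ _].
  by have [-> ->] := tauE D Dr; split=> //; apply: nef_flop hflop nefD Dr.
have [Kr _] := hflop; have [eqZ eqQ] := tauE _ Kr.
by split=> //; rewrite /delta eqZ eqQ.
Qed.
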